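(* Let $(F,\Delta,\nu)$ be the Bryc–Smolenski tower system and let $f:\Delta\to\{-1,0,1\}$ be the associated bounded observable, as defined in the context. Then $f$ is an $L^2$ coboundary with an unbounded transfer function. Explicitly, define $\psi:\Delta\to\mathbb{R}$, for $x\in\Lambda_k$ with $k\ge1$, by $$\psi(x,j)=\begin{cases}j&\text{if }0\le j\le n(k),\\ 2n(k)-j&\text{if }n(k)<j\le 2n(k)-1,\end{cases}$$ and $\psi(x,0)=0$ for $x\in\Lambda_0$. Then $\psi$ is unbounded, $\psi\in L^2(\nu)$, and $$f=\psi\circ F-\psi .$$
   Context: Let $n(0)=1/2$ and $n(k)=12^k$ for integers $k\ge1$. Let $p_k=Ce^{-n(k)/2}$ for $k\ge 0$, where $C^{-1}=\sum_{k=0}^{\infty}e^{-n(k)/2}$. Let $\Delta_0=[0,1]$ be partitioned (modulo Lebesgue-null sets) into intervals $\Lambda_0,\Lambda_1,\Lambda_2,\dots$ with $\Lambda_k$ of Lebesgue measure $p_k$. Let $R(k)=2n(k)$ for $k\ge0$ (so $R(0)=1$). The tower is $$\Delta=\{(x,j):x\in\Lambda_k,\ k\ge0,\ 0\le j\le R(k)-1\},$$ and the tower map $F:\Delta\to\Delta$ is $$F(x,j)=\begin{cases}(x,j+1)&\text{if }x\in\Lambda_k,\ j<R(k)-1,\\ (T_kx,0)&\text{if }x\in\Lambda_k,\ j=R(k)-1,\end{cases}$$ where $T_k$ has constant derivative and maps $\Lambda_k$ bijectively onto $\Delta_0$ (again modulo null sets). Lebesgue measure on the base is lifted to each level of the tower,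 giving a finite measure $\tilde\nu$ on $\Delta$, and $\nu=\tilde\nu/\tilde\nu(\Delta)$ is the normalized, $F$-invariant probability measure. The observable $f$ is defined, for $x\in\Lambda_k$ with $k\ge1$, by $f(x,j)=1$ if $0\le j\le n(k)-1$ and $f(x,j)=-1$ if $n(k)\le j\le 2n(k)-1$; and $f(x,0)=0$ for $x\in\Lambda_0$. *)

(* Defs.v *)
From HB Require Import structures.
From mathcomp Require Import all_boot all_order all_algebra.
From mathcomp Require Import all_classical all_reals all_analysis.
From mathcomp Require Import measurable_realfun ess_sup_inf.

Set Implicit Arguments.
Unset Strict Implicit.
Unset Printing Implicit Defensive.
Import Order.TTheory GRing.Theory Num.Theory.
Import numFieldNormedType.Exports.

Local Open Scope classical_set_scope.
Local Open Scope ring_scope.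

Section Weights.
Context {R : realType}.

Definition bs_n (k : nat) : R := if k == 0%N then 2^-1 else 12 ^+ k.

Definition bs_C : R := (limn (series (fun k => expR (- bs_n k / 2))))^-1.

Definition bs_p (k : nat) : R := bs_C * expR (- bs_n k / 2).

End Weights.

(* The height R(k) = 2 n(k), as a natural number; see [bs_heightE]. *)
Definition bs_height (k : nat) : nat := if k == 0%N then 1%N else (2 * 12 ^ k)%N.

Lemma bs_heightE (R : realType) (k : nat) : (bs_height k)%:R = 2 * bs_n k :> R.
Proof.
rewrite /bs_height /bs_n; case: eqP => _; first by rewrite mulfV ?pnatr_eq0.
by rewrite natrM natrX.
Qed.

(* A partition of [0, 1], up to a Lebesgue-null set, into intervals of lengths
   p_k, with the full branches T_k. The intervals are exactly disjoint, so that
   the index of a point is unambiguous; only the covering holds modulo a null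
   set. The values of T_k at the endpoints of Lam k are unconstrained. *)
Record bs_tower (R : realType) := BsTower {
  bs_Lam : nat -> set R ;
  bs_T : nat -> R -> R ;
  bs_Lam_itv : forall k, is_interval (bs_Lam k) ;
  bs_Lam_sub : forall k, bs_Lam k `<=` `[0, 1] ;
  bs_Lam_disj : trivIset setT bs_Lam ;
  bs_Lam_cover : lebesgue_measure.-negligible (`[0, 1] `\` \bigcup_k bs_Lam k) ;
  bs_Lam_length : forall k, lebesgue_measure (bs_Lam k) = (bs_p k)%:E ;
  bs_T_derive : forall k, exists c : R,
    forall x : R, (interior (bs_Lam k)) x -> is_derive x 1 (bs_T k) c ;
  bs_T_bij : forall k, exists N N' : set R,
    [/\ lebesgue_measure.-negligible N, lebesgue_measure.-negligible N' &
        set_bij (bs_Lam k `\` N) (`[0, 1] `\` N') (bs_T k)]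
}.

Section Tower.
Context {R : realType} (B : bs_tower R).

(* The tower is the subset [bs_Delta] of the ambient space R * nat. *)
Definition bs_space := (measurableTypeR R * nat)%type.

Definition bs_Delta : set bs_space :=
  [set z | exists2 k, bs_Lam B k z.1 & (z.2 < bs_height k)%N].

(* The k with x in Lam k (0 if there is none). *)
Definition bs_index (x : R) : nat := xget 0%N [set k | bs_Lam B k x].

(* Extended by the identity outside the tower. If T_k x falls in the null set
   missed by the partition then (T_k x, 0) is outside the tower. *)
Definition bs_F : bs_space -> bs_space :=
  patch id bs_Delta (fun z =>
    if (z.2 < (bs_height (bs_index z.1)).-1)%N then (z.1, z.2.+1)
    else (bs_T B (bs_index z.1) z.1, 0%N)).

(* [g \_ A] is g on A and 0 outside. *)
Definition bs_f : bs_space -> R :=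
  (fun z => if bs_index z.1 == 0%N then 0
            else if z.2%:R <= bs_n (bs_index z.1) - 1 :> R then 1 else -1 : R)
  \_ bs_Delta.

Definition bs_psi : bs_space -> R :=
  (fun z => if bs_index z.1 == 0%N then 0
            else if z.2%:R <= bs_n (bs_index z.1) :> R then z.2%:R
            else 2 * bs_n (bs_index z.1) - z.2%:R : R)
  \_ bs_Delta.

Lemma measurable_bs_Delta : measurable bs_Delta.
Proof.
rewrite (_ : bs_Delta =
    \bigcup_k (bs_Lam B k `*` [set j | (j < bs_height k)%N])); last first.
  by apply/seteqP; split => [[x j] [k xk jk]|[x j] [k _ [xk jk]]]; exists k.
apply: bigcup_measurable => k _; apply: measurableX => //.
exact: is_interval_measurable (@bs_Lam_itv _ B k).
Qed.

(* Lebesgue measure on each level R * {j} of the ambient space. *)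
Definition bs_level_measure : {measure set bs_space -> \bar R} :=
  (@lebesgue_measure R \x^ @counting nat R)%E.

Definition bs_nutilde : {measure set bs_space -> \bar R} :=
  mrestr bs_level_measure measurable_bs_Delta.

(* [mnormalize mu P] is mu / mu(T); it falls back on P only when the mass mu(T)
   is 0 or +oo, which does not happen here. *)
Definition bs_nu : probability bs_space R :=
  mnormalize bs_nutilde (\d_((0, 0%N) : bs_space)).

End Tower.

Definition L2_transfer d (T : measurableType d) (R : realType)
    (mu : {measure set T -> \bar R}) (F : T -> T) (f g : T -> R) : Prop :=
  g \in Lfun mu 2%:E /\ {ae mu, forall z, f z = g (F z) - g z}.

Definition L2_coboundary d (T : measurableType d) (R : realType)
    (mu : {measure set T -> \bar R}) (F : T -> T) (f : T -> R) : Prop :=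
  exists g, L2_transfer mu F f g.

(* Main.v *)
(** The identity [f = psi \o F - psi] is a case check on the level [j], each
    column being climbed by unit steps up to the height [n(k)] and then
    descended to [0].  The column over [Lam k] has [nutilde]-mass [2 p_k n(k)]
    and [psi <= n(k)] on it, so the mass of the tower and the integral of
    [psi ^+ 2] are dominated by [2 \sum_k p_k n(k)^i] with [i = 1] and [i = 3];
    these converge because [e^(-n/2) <= (8/n)^4].  Finally [psi = n(k)] on
    [Lam k * {n(k)}], a set of positive measure, which makes the essential
    supremum infinite. *)
Require Import Defs.
From mathcomp Require Import all_boot all_order all_algebra.
From mathcomp Require Import finmap.
From mathcomp Require Import all_classical all_reals all_analysis.
From mathcomp Require Import measurable_realfun ess_sup_inf.
From mathcomp Require Import ring lra zify.
Import Order.TTheory GRing.Theory Num.Theory.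
Import numFieldNormedType.Exports.
Local Open Scope classical_set_scope.
Local Open Scope ring_scope.

(** * Decay and summability of the weights *)

Section Weights.
Context {R : realType}.
Implicit Types (k : nat) (u : R^nat).

Lemma bs_n_gt0 k : 0 < bs_n k :> R.
Proof. by rewrite /bs_n; case: eqP => _; rewrite ?invr_gt0 ?exprn_gt0. Qed.

(** The factor 1/2 absorbs the exceptional value n(0) = 1/2, so that a single geometric bound serves
    every [k]. *)
Lemma bs_n_ge k : 12 ^+ k / 2 <= bs_n k :> R.
Proof.
rewrite /bs_n; case: eqP => [->|_]; first by rewrite expr0 mul1r.
have : 0 < 12 ^+ k :> R by rewrite exprn_gt0.
by lra.
Qed.

(* [e^(x/2) = (e^(x/8))^4 >= (x/8)^4] *)
Lemma expRN_le_expr4 (x : R) : 0 < x -> expR (- x / 2) <= (8 / x) ^+ 4.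
Proof.
move=> x0.
have -> : - x / 2 = - (4%:R * (x / 8)) by field.
rewrite expRN expRM_natl -exprVn lerXn2r ?nnegrE ?invr_ge0 ?expR_ge0//.
  by rewrite divr_ge0// ltW.
rewrite -[8 / x]invf_div lef_pV2 ?posrE ?expR_gt0 ?divr_gt0//.
by apply: le_trans (expR_ge1Dx _); rewrite lerDr.
Qed.

(** Split (8/n)^4 n^i as 8^4 n^-1 (n^-1)^(3-i). One factor n^-1 is kept for the geometric decay 2 *
    12^-k; the others are at most 2 each, hence at most 8 together, and 2 * 8 = 16. *)
Lemma bs_weight_moment_le k i : (i <= 3)%N ->
  expR (- bs_n k / 2) * bs_n k ^+ i <= (8 ^+ 4 * 16) * 12^-1 ^+ k :> R.
Proof.
move=> i3; have n0 := bs_n_gt0 k; set n := bs_n k in n0 *.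
have nV : n^-1 <= 2 * 12^-1 ^+ k.
  rewrite exprVn -[leRHS]invf_div lef_pV2 ?posrE ?divr_gt0 ?exprn_gt0//.
  exact: bs_n_ge.
have n2 : n^-1 <= 2.
  rewrite (le_trans nV)// ler_piMr// exprn_ile1//; lra.
apply: (@le_trans _ _ ((8 / n) ^+ 4 * n ^+ i)).
  by rewrite ler_wpM2r ?exprn_ge0 ?(ltW n0)// expRN_le_expr4.
have -> : (8 / n) ^+ 4 * n ^+ i = 8 ^+ 4 * n^-1 * n^-1 ^+ (3 - i).
  by case: i i3 => [|[|[|[|]]]]// _; rewrite /subn/=; field; rewrite gt_eqF.
have h : n^-1 ^+ (3 - i) <= 8.
  apply: (@le_trans _ _ (2 ^+ (3 - i))).
    by rewrite lerXn2r ?nnegrE ?invr_ge0 ?(ltW n0).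
  have -> : 8 = 2 ^+ 3 :> R by rewrite -natrX.
  by rewrite ler_weXn2l ?leq_subr// ler1n.
have nV0 : 0 <= n^-1 by rewrite invr_ge0 ltW.
rewrite (_ : (8 ^+ 4 * 16) * _ = (8 ^+ 4 * (2 * 12^-1 ^+ k)) * 8); last by ring.
by rewrite ler_pM ?exprn_ge0// ?mulr_ge0// ler_wpM2l.
Qed.

Lemma cvg_series_geometric_dominated u (c : R) : 0 <= c ->
  (forall k, 0 <= u k <= c * 12^-1 ^+ k) -> cvgn (series u).
Proof.
move=> c0 uc; apply: (@series_le_cvg _ _ (geometric c 12^-1)).
- by move=> k; have /andP[] := uc k.
- by move=> k; rewrite /geometric/= mulr_ge0// exprn_ge0.
- by move=> k; have /andP[] := uc k.
- by apply: is_cvg_geometric_series; rewrite ger0_norm ?invr_ge0//; lra.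
Qed.

Lemma nneseries_geometric_dominated_lty u (c : R) : 0 <= c ->
  (forall k, 0 <= u k <= c * 12^-1 ^+ k) ->
  (\sum_(k <oo) (u k)%:E < +oo)%E.
Proof.
move=> c0 /(cvg_series_geometric_dominated _ _ c0) cu.
rewrite (_ : (fun n => _) = EFin \o series u).
  by rewrite EFin_lim// ltry.
by apply/funext => n; rewrite sumEFin.
Qed.

(** The limit defining [bs_C] is informative only once the series is known to converge; it then
    dominates its positive first term. *)
Lemma bs_C_gt0 : 0 < bs_C :> R.
Proof.
rewrite invr_gt0; set u := (X in series X).
have cu : cvgn (series u).
  apply: (@cvg_series_geometric_dominated _ (8 ^+ 4 * 16)) => // k.
  by rewrite expR_ge0 -[leLHS]mulr1; apply: (bs_weight_moment_le k 0).
apply: lt_le_trans (nondecreasing_cvgn_le _ cu 1%N).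
  by rewrite /series/= big_nat1 expR_gt0.
by apply: nondecreasing_series => k _ _; rewrite expR_ge0.
Qed.

Lemma bs_p_gt0 k : 0 < bs_p k :> R.
Proof. by rewrite mulr_gt0 ?bs_C_gt0 ?expR_gt0. Qed.

Lemma bs_p_moment_lty (c : R) i : 0 <= c -> (i <= 3)%N ->
  (\sum_(k <oo) (c * (bs_p k * bs_n k ^+ i))%:E < +oo)%E.
Proof.
move=> c0 i3; have C0 := ltW bs_C_gt0.
apply: (@nneseries_geometric_dominated_lty _ (c * bs_C * (8 ^+ 4 * 16))) => [|k].
  by rewrite !mulr_ge0.
apply/andP; split.
  by rewrite !mulr_ge0 ?exprn_ge0 ?(ltW (bs_p_gt0 k)) ?(ltW (bs_n_gt0 k)).
rewrite /bs_p -[leRHS]mulrA -(mulrA bs_C) mulrA ler_wpM2l ?mulr_ge0//.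
exact: bs_weight_moment_le.
Qed.

End Weights.

(** * Columns of the tower and the coboundary identity *)

Section Tower.
Context {R : realType} (B : bs_tower R).
Implicit Types (k : nat) (x : R) (z : @bs_space R).

Definition bs_column k : set (@bs_space R) :=
  bs_Lam B k `*` [set j | (j < bs_height k)%N].

Lemma bs_indexE k x : bs_Lam B k x -> bs_index B x = k.
Proof.
move=> kx; apply: xget_unique => // l lx.
by apply: (@bs_Lam_disj _ B) => //; exists x.
Qed.

Lemma bs_psiE z : bs_Delta B z -> bs_psi B z =
  if bs_index B z.1 == 0%N then 0
  else if z.2%:R <= bs_n (bs_index B z.1) :> R then z.2%:R
  else 2 * bs_n (bs_index B z.1) - z.2%:R.
Proof. by move=> Dz; rewrite /bs_psi patchT// inE. Qed.

(** Holds for every real [x], so the return to the base needs no information on where T_k sends a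
    point, even if it leaves the partition. *)
Lemma bs_psi_base x : bs_psi B (x, 0%N) = 0.
Proof.
have [D|D] := pselect (bs_Delta B (x, 0%N)).
  by rewrite bs_psiE//=; case: ifP => // _; rewrite ltW ?bs_n_gt0.
by rewrite /bs_psi patchC// inE.
Qed.

Lemma bs_n_nat k : k != 0%N -> bs_n k = (12 ^ k)%:R :> R.
Proof. by rewrite /bs_n natrX => /negbTE ->. Qed.

Lemma bs_height_nat k : k != 0%N -> bs_height k = (2 * 12 ^ k)%N.
Proof. by rewrite /bs_height => /negbTE ->. Qed.

Lemma bs_f_psi z :
  bs_Delta B z -> bs_f B z = bs_psi B (bs_F B z) - bs_psi B z.
Proof.
move=> Dz; rewrite /bs_F /bs_f !patchT ?inE// (bs_psiE _ Dz).
case: z Dz => x j Dz; have [k /= kx jk] := Dz.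
rewrite (bs_indexE _ _ kx); have [k0|k0] := eqVneq k 0%N.
  by rewrite k0 /= bs_psi_base subrr.
(* Strictness places the top level 2 n(k) - 1 above n(k), on the descending branch. *)
have n1 : (1 < 12 ^ k)%N by rewrite -[1%N](expn0 12) ltn_exp2l// lt0n.
rewrite bs_n_nat//; rewrite bs_height_nat// in jk *.
rewrite (_ : _ - 1 = (12 ^ k - 1)%:R :> R); last by rewrite (natrB _ (ltnW n1)).
rewrite !ler_nat.
case: ltnP => [jlt|jge].
  rewrite bs_psiE/= ?(bs_indexE _ _ kx) ?(negbTE k0) ?bs_n_nat ?ler_nat//; last first.
    by exists k => //=; rewrite bs_height_nat//; move: jlt jk; lia.
  case: (leqP j (12 ^ k - 1)) => h1; case: (leqP j.+1 (12 ^ k)) => h2;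
    case: (leqP j (12 ^ k)) => h3; try (exfalso; lia).
  - by rewrite -natr1; ring.
  (* At the crest, psi is read from the ascending branch and its successor from the descending one:
     2 n(k) - (j + 1) - j = -1 because j = n(k). *)
  - rewrite (_ : j = 12 ^ k)%N; last lia.
    by rewrite -natr1; ring.
  - by rewrite -natr1; ring.
(* Top level: psi is 1 there and 0 at the image in the base, while f is -1. *)
have -> : j = (2 * 12 ^ k).-1 by lia.
rewrite bs_psi_base.
rewrite !ifN; [|lia|lia].
by rewrite -subn1 natrB ?natrM; [ring|lia].
Qed.

(** * Measurability, column by column *)

Lemma measurable_bs_Lam k : measurable (bs_Lam B k).
Proof. exact: is_interval_measurable (@bs_Lam_itv R B k). Qed.

Lemma measurable_bs_column k : measurable (bs_column k).
Proof. by apply: measurableX => //; exact: measurable_bs_Lam. Qed.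

Lemma bigcup_bs_column : \bigcup_k bs_column k = bs_Delta B.
Proof.
by apply/seteqP; split => [[x j] [k _ [xk jk]]|[x j] [k xk jk]]; exists k.
Qed.

Lemma trivIset_bs_column : trivIset setT bs_column.
Proof.
move=> i j _ _ [[x m] [[xi _] [xj _]]].
by apply: (@bs_Lam_disj _ B) => //; exists x.
Qed.

Lemma bs_psi_bound k z : bs_column k z -> 0 <= bs_psi B z <= bs_n k.
Proof.
case: z => x j [/= kx jk]; rewrite bs_psiE; last by exists k.
rewrite /= (bs_indexE _ _ kx); have n0 := @bs_n_gt0 R k.
case: ifP => _; first by rewrite lexx ltW.
have hj : j%:R <= 2 * bs_n k :> R by rewrite -bs_heightE ler_nat ltnW.
case: ifPn => [->|nj]; first by rewrite ler0n.
by rewrite -ltNge in nj; apply/andP; split; lra.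
Qed.

(** On one column the index is constant, so psi is a function of the discrete level alone; countably
    many columns are then glued. *)
Lemma measurable_bs_psi : measurable_fun setT (bs_psi B).
Proof.
rewrite /bs_psi; apply: (iffLR (measurable_restrictT _ (measurable_bs_Delta B))).
rewrite -bigcup_bs_column; apply: (iffRL (measurable_fun_bigcup _ _)) => k.
  exact: measurable_bs_column.
pose g (j : nat) : R := if k == 0%N then 0
  else if j%:R <= bs_n k :> R then j%:R else 2 * bs_n k - j%:R.
apply: (eq_measurable_fun (g \o snd)).
  by move=> z; rewrite inE => -[kz _]; rewrite /= (bs_indexE _ _ kz).
by apply: measurableT_comp => //; exact: measurable_funTS.
Qed.

(** * Mass of the columns and normalization *)

Lemma counting_below (n : nat) :
  counting [set j | (j < n)%N] = n%:R%:E :> \bar R.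
Proof.
rewrite -/(`I_n) /counting asboolT; last exact: finite_II.
by rewrite (@card_fset_set _ _ n)//.
Qed.

Lemma bs_level_measure_box k (J : set nat) :
  (@bs_level_measure R (bs_Lam B k `*` J) = (bs_p k)%:E * counting J)%E.
Proof.
rewrite -(bs_Lam_length B); apply: product_measure2E => //.
exact: measurable_bs_Lam.
Qed.

Lemma bs_nutilde_column k :
  bs_nutilde B (bs_column k) = (2 * (bs_p k * bs_n k))%:E.
Proof.
rewrite /bs_nutilde /= /mrestr setIidl; last first.
  by rewrite -bigcup_bs_column; exact: bigcup_sup.
rewrite bs_level_measure_box counting_below bs_heightE -EFinM.
by congr EFin; ring.
Qed.

Lemma bs_nutilde_setT_gt0 : (0 < bs_nutilde B setT)%E.
Proof.
apply: (@lt_le_trans _ _ (bs_nutilde B (bs_column 0))).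
  by rewrite bs_nutilde_column lte_fin mulr_gt0// mulr_gt0// ?bs_p_gt0 ?bs_n_gt0.
by apply: le_measure; rewrite ?inE//; exact: measurable_bs_column.
Qed.

Lemma bs_nutilde_setT_lty : (bs_nutilde B setT < +oo)%E.
Proof.
have -> : bs_nutilde B setT = bs_nutilde B (\bigcup_k bs_column k).
  by rewrite bigcup_bs_column /bs_nutilde/= /mrestr setTI setIid.
rewrite measure_bigcup; [|by move=> k _; exact: measurable_bs_column
  |exact: trivIset_bs_column].
rewrite (eq_eseriesr (g := fun k => (2 * (bs_p k * bs_n k ^+ 1))%:E)).
  rewrite (eq_eseriesl (Q := xpredT)); last by move=> k; exact: in_setT.
  exact: bs_p_moment_lty.
by move=> k _; rewrite bs_nutilde_column expr1.
Qed.

Definition bs_mass : R := fine (bs_nutilde B setT).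

Lemma bs_mass_gt0 : 0 < bs_mass.
Proof.
by apply: fine_gt0; rewrite bs_nutilde_setT_gt0 bs_nutilde_setT_lty.
Qed.

(** Positivity and finiteness of the total mass exclude the fallback branch of [mnormalize]. *)
Lemma bs_nuE (U : set (@bs_space R)) :
  (bs_nu B U = bs_nutilde B U * (bs_mass^-1)%:E)%E.
Proof.
rewrite /bs_nu/= /mnormalize ifF//; apply/negbTE; rewrite negb_or.
by rewrite gt_eqF ?bs_nutilde_setT_gt0// lt_eqF ?bs_nutilde_setT_lty.
Qed.

(** * Square-integrability of psi *)

Lemma bs_psi_Lfun2 : bs_psi B \in Lfun (bs_nu B) 2%:E.
Proof.
rewrite inE/=; apply/andP; split; rewrite inE/=; first exact: measurable_bs_psi.
rewrite /finite_norm unlock poweR_lty//.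
have mg : measurable_fun setT (fun z => ((bs_psi B z) ^+ 2)%:E).
  by apply/measurable_EFinP; apply: measurable_funX; exact: measurable_bs_psi.
have -> : (\int[bs_nu B]_z (`|(EFin \o bs_psi B) z| `^ 2) =
    \int[bs_nu B]_(z in bs_Delta B) ((bs_psi B z) ^+ 2)%:E)%E.
  rewrite [RHS]integral_mkcond; apply: eq_integral => z _.
  rewrite /= patchE powR_mulrn// real_normK ?num_real//.
  by case: ifPn => // zD; rewrite /bs_psi patchE (negbTE zD) expr0n.
rewrite -bigcup_bs_column ge0_integral_bigcup; last 4 first.
- exact: measurable_bs_column.
- exact: measurable_funTS.
- by move=> z _; rewrite lee_fin sqr_ge0.
- exact: trivIset_bs_column.
(* A column has normalized mass 2 p_k n(k) / [bs_mass], and psi^2 <= n(k)^2 on it: hence the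
   constant and the third moment. *)
apply: le_lt_trans (bs_p_moment_lty (2 * bs_mass^-1) 3 _ _) => //; last first.
  by rewrite mulr_ge0// invr_ge0 ltW// bs_mass_gt0.
apply: lee_nneseries => k _.
  by move=> _; apply: integral_ge0 => z _; rewrite lee_fin sqr_ge0.
apply: (@le_trans _ _ (\int[bs_nu B]_(z in bs_column k) (cst ((bs_n k) ^+ 2)%:E z))%E).
  apply: ge0_le_integral => //.
  - exact: measurable_bs_column.
  - by move=> z _; rewrite lee_fin sqr_ge0.
  - exact: measurable_funTS.
  - move=> z /bs_psi_bound/andP[h1 h2].
    by rewrite lee_fin lerXn2r// nnegrE (le_trans h1).
have -> := integral_cst (bs_nu B) (measurable_bs_column k) ((bs_n k) ^+ 2)%:E.
rewrite [X in (_ * X)%E](bs_nuE (bs_column k)) bs_nutilde_column -!EFinM lee_fin.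
by rewrite le_eqVlt; apply/orP; left; apply/eqP; ring.
Qed.

(** * Unboundedness, pointwise and essential *)

Lemma bs_psi_crest k x : (0 < k)%N -> bs_Lam B k x ->
  bs_Delta B (x, 12 ^ k)%N /\ bs_psi B (x, 12 ^ k)%N = 12 ^+ k.
Proof.
move=> k_gt0 kx; have k0 : k != 0%N by rewrite -lt0n.
(* For k > 0, n(k) = 12^k is an integer level, half way up a column of height 2 n(k). *)
have D : bs_Delta B (x, 12 ^ k)%N.
  exists k => //=; rewrite bs_height_nat//.
  by rewrite mul2n -addnn -[ltnLHS]addn0 ltn_add2l expn_gt0.
split=> //; rewrite bs_psiE//= (bs_indexE _ _ kx) (negbTE k0).
by rewrite bs_n_nat// lexx natrX.
Qed.

Lemma expr12_unbounded (M : R) : exists2 k, (0 < k)%N & M < 12 ^+ k.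
Proof.
(* This exponent m already exceeds M, and m < 12^m. *)
exists (Num.truncn `|M|).+1 => //.
apply: (le_lt_trans (ler_norm M)); apply: (lt_trans (truncnS_gt _)).
by rewrite -natrX ltr_nat ltn_expl.
Qed.

Lemma bs_nu_crest_gt0 k : (0 < k)%N ->
  (0 < bs_nu B (bs_Lam B k `*` [set (12 ^ k)%N]))%E.
Proof.
move=> k0; rewrite bs_nuE mule_gt0 ?lte_fin ?invr_gt0 ?bs_mass_gt0//.
rewrite /bs_nutilde/= /mrestr setIidl.
  rewrite bs_level_measure_box /counting asboolT; last exact: finite_set1.
  by rewrite fset_set1 cardfs1 mule1 lte_fin bs_p_gt0.
by move=> [x j] [/= kx ->]; have [] := bs_psi_crest k x k0 kx.
Qed.

Lemma bs_psi_unbounded (M : R) : exists2 z, bs_Delta B z & M < `|bs_psi B z|.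
Proof.
have [k k0 Mk] := expr12_unbounded M.
have [x kx] : bs_Lam B k !=set0.
  apply/set0P/eqP => L0; have := bs_Lam_length B k.
  by rewrite L0 measure0 => -[] /eqP; rewrite lt_eqF ?bs_p_gt0.
have [D E] := bs_psi_crest k x k0 kx.
by exists (x, 12 ^ k)%N => //; rewrite E (lt_le_trans Mk)// ler_norm.
Qed.

(** A finite essential bound M would put every crest slice with 12^k > M inside a null set, against
    its positive measure. *)
Lemma bs_psi_ess_sup : ess_sup (bs_nu B) (fun z => `|bs_psi B z|%:E) = +oo%E.
Proof.
apply/eqP; rewrite -leye_eq leNgt; apply/negP => /ess_supr_bounded[M].
move=> [N [mN N0 MN]]; have [k k0 Mk] := expr12_unbounded M.
have := bs_nu_crest_gt0 k k0; rewrite ltNge => /negP; apply.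
rewrite -N0; apply: le_measure; rewrite ?inE//.
  by apply: measurableX => //; exact: measurable_bs_Lam.
move=> [x j] [/= kx ->]; apply: MN => /=.
have [_ ->] := bs_psi_crest k x k0 kx.
by apply/negP; rewrite -ltNge (lt_le_trans Mk)// ler_norm.
Qed.

(** No exceptional set arises: off the tower [bs_F] is the identity and [bs_f] is 0, so both sides
    vanish. *)
Lemma bs_f_psi_ae :
  {ae bs_nu B, forall z, bs_f B z = bs_psi B (bs_F B z) - bs_psi B z}.
Proof.
apply: nearW => z; have [D|D] := pselect (bs_Delta B z); first exact: bs_f_psi.
by rewrite /bs_F /bs_f !patchC ?inE// subrr.
Qed.

End Tower.

Theorem mainTheorem3 (R : realType) (B : bs_tower R) :
  [/\ L2_coboundary (bs_nu B) (bs_F B) (bs_f B),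
      forall M : R, exists2 z, bs_Delta B z & M < `|bs_psi B z|,
      ess_sup (bs_nu B) (fun z => `|bs_psi B z|%:E) = +oo%E,
      bs_psi B \in Lfun (bs_nu B) 2%:E &
      forall z, bs_Delta B z -> bs_f B z = bs_psi B (bs_F B z) - bs_psi B z].
Proof.
split.
- by exists (bs_psi B); split; [exact: bs_psi_Lfun2|exact: bs_f_psi_ae].
- exact: bs_psi_unbounded.
- exact: bs_psi_ess_sup.
- exact: bs_psi_Lfun2.
- exact: bs_f_psi.
Qed.
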